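(* Let $Q\in\mathbb{R}^{n\times n}$ be symmetric, positive definite and strictly block diagonally dominant relative to $p=[n_1,\dots,n_N]^T$. Let $A=\mathrm{diag}(\alpha_1I_{n_1},\dots,\alpha_NI_{n_N})$ with $\alpha_i>0$ for all $i\in[N]$. Let $f(x)=\frac12x^TQx+r^Tx$, where $r,x\in\mathbb{R}^n$ and $r\neq0$. Let $\hat{x}=\arg\min_{x\in\mathbb{R}^n}f(x)=-Q^{-1}r$ and $\hat{x}_A=\arg\min_{x\in\mathbb{R}^n}\big(f(x)+\frac12x^TAx\big)=-P^{-1}r$, where $P=Q+A$. Let $\epsilon\in(0,1)$. If $$\alpha_i\le\frac{\sqrt{\epsilon}}{1-\sqrt{\epsilon}}\,\delta_i(Q)\quad\text{for all }i\in[N],$$ then $$\frac{|f(\hat{x})-f(\hat{x}_A)|}{|f(\hat{x})|}\le\epsilon.$$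
   Context: Notation: $[N]=\{1,\dots,N\}$, $n_i\ge1$, $n=\sum_{i=1}^Nn_i$. A matrix $B\in\mathbb{R}^{n\times n}$ is partitioned into blocks $B^{[i]}_j\in\mathbb{R}^{n_i\times n_j}$, $i,j\in[N]$. $\|\cdot\|_2$ is the induced 2-norm. $B$ is strictly block diagonally dominant relative to $p$ if every $B^{[i]}_i$ is nonsingular and $\delta_i(B)>0$ for all $i\in[N]$, where $\delta_i(B)=\big(\|(B^{[i]}_i)^{-1}\|_2\big)^{-1}-\sum_{j\ne i}\|B^{[i]}_j\|_2$. *)

(* Defs.v *)
From HB Require Import structures.
From mathcomp Require Import all_boot all_order all_algebra.
From mathcomp Require Import classical_sets reals.

Set Implicit Arguments.
Unset Strict Implicit.
Unset Printing Implicit Defensive.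

Import Order.TTheory GRing.Theory Num.Theory.

Local Open Scope ring_scope.
Local Open Scope classical_set_scope.

(* The norm that normedtype puts on matrices and vectors is the max
   norm, hence these two definitions. *)
Definition vnorm2 (R : realType) (n : nat) (x : 'cV[R]_n) : R :=
  Num.sqrt (\sum_(k < n) x k 0 ^+ 2).

Definition mnorm2 (R : realType) (m n : nat) (M : 'M[R]_(m, n)) : R :=
  sup [set vnorm2 (M *m x) | x in [set x : 'cV[R]_n | vnorm2 x <= 1]].

Definition qform (R : realType) (n : nat) (M : 'M[R]_n) (x : 'cV[R]_n) : R :=
  (x^T *m M *m x) 0 0.

Definition posdefmx (R : realType) (n : nat) (M : 'M[R]_n) : Prop :=
  forall x : 'cV[R]_n, x != 0 -> 0 < qform M x.

(* submxblock B i j is the block B^[i]_j. *)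
Definition bdelta (R : realType) (N : nat) (p : 'I_N -> nat)
    (B : 'M[R]_(\sum_(i < N) p i)) (i : 'I_N) : R :=
  (mnorm2 (invmx (submxblock B i i)))^-1
  - \sum_(j < N | j != i) mnorm2 (submxblock B i j).

Definition strictly_block_diag_dominant (R : realType) (N : nat)
    (p : 'I_N -> nat) (B : 'M[R]_(\sum_(i < N) p i)) : Prop :=
  (forall i : 'I_N, submxblock B i i \in unitmx) /\
  (forall i : 'I_N, 0 < bdelta B i).

Definition is_argmin (R : realType) (n : nat) (g : 'cV[R]_n -> R)
    (x : 'cV[R]_n) : Prop :=
  forall y : 'cV[R]_n, y != x -> g x < g y.

(* Main.v *)
(** With [u = xhatA] and [d = xhat - xhatA] the optimality equations give
    [Q d = A u], and [f xhatA - f xhat = d^T Q d / 2], [f xhat = - xhat^T Q xhat / 2].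
    Block diagonal dominance yields [Q >= diag(delta_i I)] in the Loewner order,
    so [A <= c Q] with [c = t / (1 - t)] and [t = sqrt eps].  Cauchy-Schwarz for
    the form [A] then gives [d^T Q d <= c (u^T A u)], and expanding
    [xhat = u + d] in [t^2 (xhat^T Q xhat) - d^T Q d] leaves a nonnegative
    quantity. *)

Require Import Defs.
From mathcomp Require Import all_boot all_order all_algebra.
From mathcomp Require Import classical_sets reals.
From mathcomp Require Import ring lra.

Set Implicit Arguments.
Unset Strict Implicit.
Unset Printing Implicit Defensive.

Import Order.TTheory GRing.Theory Num.Theory.

Local Open Scope ring_scope.

(** * Euclidean inner product, quadratic forms and Cauchy-Schwarz *)

Definition dotv {R : realType} {n : nat} (x y : 'cV[R]_n) : R := (x^T *m y) 0 0.

Section DotProduct.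
Context {R : realType}.
Implicit Types m n : nat.

Lemma dotvE n (x y : 'cV[R]_n) : dotv x y = \sum_k x k 0 * y k 0.
Proof. by rewrite /dotv mxE; apply: eq_bigr => k _; rewrite mxE. Qed.

Lemma dotvC n (x y : 'cV[R]_n) : dotv x y = dotv y x.
Proof. by rewrite !dotvE; apply: eq_bigr => k _; rewrite mulrC. Qed.

Lemma dotvDl n (x y z : 'cV[R]_n) : dotv (x + y) z = dotv x z + dotv y z.
Proof. by rewrite /dotv linearD mulmxDl mxE. Qed.

Lemma dotvZl n a (x z : 'cV[R]_n) : dotv (a *: x) z = a * dotv x z.
Proof. by rewrite /dotv linearZ -scalemxAl mxE. Qed.

Lemma dotv0l n (x : 'cV[R]_n) : dotv 0 x = 0.
Proof. by rewrite /dotv trmx0 mul0mx mxE. Qed.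

Lemma dotvNl n (x z : 'cV[R]_n) : dotv (- x) z = - dotv x z.
Proof. by rewrite -scaleN1r dotvZl mulN1r. Qed.

Lemma dotvDr n (z x y : 'cV[R]_n) : dotv z (x + y) = dotv z x + dotv z y.
Proof. by rewrite !(dotvC z) dotvDl. Qed.

Lemma dotvZr n a (z x : 'cV[R]_n) : dotv z (a *: x) = a * dotv z x.
Proof. by rewrite !(dotvC z) dotvZl. Qed.

Lemma dotvNr n (z x : 'cV[R]_n) : dotv z (- x) = - dotv z x.
Proof. by rewrite !(dotvC z) dotvNl. Qed.

Lemma dotv_mull m n (M : 'M[R]_(m, n)) x y : dotv (M *m x) y = dotv x (M^T *m y).
Proof. by rewrite /dotv trmx_mul mulmxA. Qed.

Lemma dotv_ge0 n (x : 'cV[R]_n) : 0 <= dotv x x.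
Proof. by rewrite dotvE sumr_ge0 // => k _; rewrite -expr2 sqr_ge0. Qed.

Lemma qformE n (M : 'M[R]_n) x : qform M x = dotv x (M *m x).
Proof. by rewrite /qform /dotv mulmxA. Qed.

Lemma qformD n (M M' : 'M[R]_n) x : qform (M + M') x = qform M x + qform M' x.
Proof. by rewrite !qformE mulmxDl dotvDr. Qed.

(** Homogeneity in [s] and [t] avoids division: [(b, -a)] gives [0 <= a * (a * c - b ^+ 2)], and
    [(-c, b)] gives the same with factor [c]. If [a = c = 0], the point [(1, -b)] forces [b = 0]. *)
Lemma discriminant_le (a b c : R) :
  (forall s t, 0 <= s ^+ 2 * a + 2 * s * t * b + t ^+ 2 * c) -> b ^+ 2 <= a * c.
Proof.
move=> H.
have a0 : 0 <= a by have := H 1 0; lra.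
have c0 : 0 <= c by have := H 0 1; lra.
have [a1|] := ltP 0 a.
  have : 0 <= a * (a * c - b ^+ 2) by have := H b (- a); nra.
  by rewrite pmulr_rge0 // subr_ge0.
move=> a1; have az : a = 0 by lra.
have [c1|c1] := ltP 0 c; last first.
  by have := H 1 (- b); rewrite az; nra.
have : 0 <= c * (a * c - b ^+ 2) by have := H (- c) b; nra.
by rewrite pmulr_rge0 // az mul0r subr_ge0.
Qed.

Lemma cauchy_schwarz_qform n (M : 'M[R]_n) (x y : 'cV[R]_n) :
  M^T = M -> (forall z, 0 <= qform M z) ->
  dotv x (M *m y) ^+ 2 <= qform M x * qform M y.
Proof.
move=> Msym Mpos; apply: discriminant_le => s t.
have := Mpos (s *: x + t *: y); rewrite !qformE mulmxDr -!scalemxAr.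
rewrite !(dotvDl, dotvDr, dotvZl, dotvZr).
have -> : dotv y (M *m x) = dotv x (M *m y) by rewrite dotvC dotv_mull Msym.
by congr (_ <= _); ring.
Qed.

Lemma vnorm2_ge0 n (x : 'cV[R]_n) : 0 <= vnorm2 x.
Proof. exact: sqrtr_ge0. Qed.

Lemma sqr_vnorm2 n (x : 'cV[R]_n) : vnorm2 x ^+ 2 = dotv x x.
Proof.
rewrite /vnorm2 sqr_sqrtr; first by rewrite dotvE; apply: eq_bigr.
by apply: sumr_ge0 => k _; rewrite sqr_ge0.
Qed.

Lemma vnorm2E n (x : 'cV[R]_n) : vnorm2 x = Num.sqrt (dotv x x).
Proof. by rewrite -sqr_vnorm2 sqrtr_sqr ger0_norm // vnorm2_ge0. Qed.

Lemma cauchy_schwarz n (x y : 'cV[R]_n) : `|dotv x y| <= vnorm2 x * vnorm2 y.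
Proof.
rewrite -ler_sqr ?nnegrE ?mulr_ge0 ?vnorm2_ge0 //.
rewrite real_normK ?num_real // exprMn !sqr_vnorm2.
have := @cauchy_schwarz_qform n 1%:M x y (trmx1 _ _).
rewrite !qformE !mul1mx; apply=> z.
by rewrite qformE mul1mx dotv_ge0.
Qed.

Lemma vnorm2_eq0 n (x : 'cV[R]_n) : vnorm2 x = 0 -> x = 0.
Proof.
move=> x0; apply/matrixP => k j; rewrite ord1 !mxE; apply/eqP.
have : dotv x x == 0 by rewrite -sqr_vnorm2 x0 expr0n.
rewrite dotvE psumr_eq0 => [/allP/(_ k)|i _]; last by rewrite -expr2 sqr_ge0.
by rewrite mem_index_enum -expr2 sqrf_eq0 => /(_ isT).
Qed.

Lemma vnorm2Z n a (x : 'cV[R]_n) : vnorm2 (a *: x) = `|a| * vnorm2 x.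
Proof.
rewrite !vnorm2E dotvZl dotvZr mulrA -expr2 sqrtrM ?sqr_ge0 //.
by rewrite sqrtr_sqr.
Qed.

Lemma vnorm20 n : vnorm2 (0 : 'cV[R]_n) = 0.
Proof. by rewrite vnorm2E dotv0l sqrtr0. Qed.

End DotProduct.

(** * The induced 2-norm and its invariance under transposition *)

Section OperatorNorm.
Context {R : realType}.

(** Makes the [sup] in [mnorm2] a genuine supremum. The bound is the Frobenius norm, by
    Cauchy-Schwarz on each row. *)
Lemma mnorm2_has_ubound m n (M : 'M[R]_(m, n)) :
  has_ubound [set vnorm2 (M *m x) | x in [set x : 'cV[R]_n | vnorm2 x <= 1]]%classic.
Proof.
pose F := \sum_i dotv (row i M)^T (row i M)^T.
have F0 : 0 <= F by apply: sumr_ge0 => i _; apply: dotv_ge0.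
exists (Num.sqrt F) => _ [x /= x1 <-].
rewrite vnorm2E ler_wsqrtr // dotvE /F; apply: ler_sum => i _.
have -> : (M *m x) i 0 = dotv (row i M)^T x.
  by rewrite /dotv trmxK -row_mul [RHS]mxE.
rewrite -expr2 -[dotv _^T _^T]sqr_vnorm2.
rewrite -[_ ^+ 2]real_normK ?num_real // ler_sqr ?nnegrE ?vnorm2_ge0 //.
apply: le_trans (cauchy_schwarz _ _) _.
by rewrite ler_piMr ?vnorm2_ge0.
Qed.

Lemma mnorm2_ge0 m n (M : 'M[R]_(m, n)) : 0 <= mnorm2 M.
Proof.
apply: ub_le_sup (mnorm2_has_ubound M) _ _.
by exists 0; rewrite /= ?mulmx0 vnorm20 ?ler01.
Qed.

Lemma vnorm2_mulmx_le m n (M : 'M[R]_(m, n)) x :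
  vnorm2 (M *m x) <= mnorm2 M * vnorm2 x.
Proof.
have [x0|x0] := eqVneq (vnorm2 x) 0.
  have := x0 => /vnorm2_eq0 ->.
  by rewrite mulmx0 !vnorm20 mulr0.
have xp : 0 < vnorm2 x by rewrite lt_neqAle eq_sym x0 vnorm2_ge0.
rewrite -ler_pdivrMr // mulrC.
have -> : (vnorm2 x)^-1 * vnorm2 (M *m x) = vnorm2 (M *m ((vnorm2 x)^-1 *: x)).
  by rewrite -scalemxAr [RHS]vnorm2Z ger0_norm // invr_ge0 vnorm2_ge0.
apply: ub_le_sup (mnorm2_has_ubound M) _ _.
exists ((vnorm2 x)^-1 *: x) => //=.
by rewrite vnorm2Z ger0_norm ?invr_ge0 ?vnorm2_ge0 // mulVf.
Qed.

Lemma mnorm2_le m n (M : 'M[R]_(m, n)) a :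
  0 <= a -> (forall x, vnorm2 (M *m x) <= a * vnorm2 x) -> mnorm2 M <= a.
Proof.
move=> a0 H; apply: ge_sup.
  exists (vnorm2 (M *m 0)), 0 => //=.
  by rewrite vnorm20 ler01.
move=> _ [x /= x1 <-]; apply: le_trans (H x) _.
by rewrite ler_piMr.
Qed.

Lemma dotv_mulmx_le m n (M : 'M[R]_(m, n)) x y :
  `|dotv x (M *m y)| <= mnorm2 M * (vnorm2 x * vnorm2 y).
Proof.
apply: le_trans (cauchy_schwarz _ _) _; rewrite mulrCA.
by rewrite ler_wpM2l ?vnorm2_ge0 ?vnorm2_mulmx_le.
Qed.

(** With [v] the norm of [M^T x], [v ^+ 2] is the product of [x] with [M (M^T x)], hence at most
    [mnorm2 M * vnorm2 x * v]; then cancel [v]. *)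
Lemma mnorm2_tr_le m n (M : 'M[R]_(m, n)) : mnorm2 M^T <= mnorm2 M.
Proof.
apply: mnorm2_le (mnorm2_ge0 M) _ => x.
set v := vnorm2 _.
have H : v ^+ 2 <= mnorm2 M * vnorm2 x * v.
  rewrite sqr_vnorm2 dotv_mull trmxK -mulrA.
  exact: le_trans (ler_norm _) (dotv_mulmx_le _ _ _).
have [v0|v0] := eqVneq v 0; first by rewrite v0 mulr_ge0 ?mnorm2_ge0 ?vnorm2_ge0.
by move: H; rewrite expr2 ler_pM2r // lt_neqAle eq_sym v0 vnorm2_ge0.
Qed.

Lemma mnorm2_tr m n (M : 'M[R]_(m, n)) : mnorm2 M^T = mnorm2 M.
Proof. by apply/le_anti; rewrite mnorm2_tr_le -{1}(trmxK M) mnorm2_tr_le. Qed.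

End OperatorNorm.

(** * Positive definite matrices and a lower bound by the norm of the inverse *)

Section PositiveDefinite.
Context {R : realType} {n : nat}.
Implicit Types M : 'M[R]_n.

Lemma posdefmx_ge0 M x : posdefmx M -> 0 <= qform M x.
Proof.
move=> Mpos; have [->|/Mpos/ltW//] := eqVneq x 0.
by rewrite qformE dotv0l.
Qed.

Lemma posdefmx_unit M : M^T = M -> posdefmx M -> M \in unitmx.
Proof.
move=> Msym Mpos; rewrite -row_free_unit; apply: inj_row_free => v vM.
apply/eqP; rewrite -(inj_eq (@trmx_inj _ _ _)) trmx0; apply: contraT => /Mpos.
by rewrite /qform trmxK vM mul0mx mxE ltxx.
Qed.

(* Cauchy-Schwarz for the form [M^-1] between [x] and [M x]. *)
Lemma posdefmx_ge_mnorm2_inv M x : M^T = M -> posdefmx M ->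
  (mnorm2 (invmx M))^-1 * dotv x x <= qform M x.
Proof.
move=> Msym Mpos; have Mu := posdefmx_unit Msym Mpos.
set B := invmx M; set b := mnorm2 B.
have b0 : 0 <= b by apply: mnorm2_ge0.
(* Occurs only in dimension 0; the convention [0^-1 = 0] makes the left side vanish. *)
have [bz|bz] := eqVneq b 0; first by rewrite bz invr0 mul0r posdefmx_ge0.
have bp : 0 < b by rewrite lt_neqAle eq_sym bz.
rewrite mulrC ler_pdivrMr // mulrC.
have [->|xn0] := eqVneq x 0.
  by rewrite qformE !dotv0l mulr0.
have qB z : qform B z = qform M (B *m z).
  by rewrite !qformE mulKVmx // dotvC.
have Bsym : B^T = B by rewrite /B trmx_inv Msym.
have Bx : B *m (M *m x) = x by rewrite mulKmx.
have := @cauchy_schwarz_qform _ _ B x (M *m x) Bsym.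
rewrite Bx (qB (M *m x)) Bx => H.
have {H} : dotv x x ^+ 2 <= qform B x * qform M x.
  by apply: H => z; rewrite qB posdefmx_ge0.
have : qform B x <= b * dotv x x.
  rewrite qformE -sqr_vnorm2 expr2.
  exact: le_trans (ler_norm _) (dotv_mulmx_le _ _ _).
have : 0 < dotv x x.
  rewrite -sqr_vnorm2 exprn_gt0 // lt_neqAle vnorm2_ge0 andbT eq_sym.
  by apply: contra xn0 => /eqP/vnorm2_eq0/eqP.
(* From [s ^+ 2 <= p * q] and [p <= b * s] follows [s ^+ 2 <= b * s * q]; cancel [s > 0]. *)
have := posdefmx_ge0 x Mpos; move: (qform B x) (qform M x) (dotv x x) => p q s.
move=> q0 s0 ps /le_trans/(_ (ler_wpM2r q0 ps)).
by rewrite expr2 mulrAC ler_pM2r.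
Qed.

End PositiveDefinite.

(** * Exact expansion of a quadratic function at its critical point *)

Section QuadraticMinimum.
Context {R : realType} {n : nat}.
Variables (M : 'M[R]_n) (r x0 : 'cV[R]_n).
Hypotheses (Msym : M^T = M) (Mx0 : M *m x0 = - r).

Let g x := 2^-1 * qform M x + dotv r x.

(** [Mx0] says that the gradient vanishes at [x0], so the expansion there has no linear term. *)
Lemma quadratic_gap y : g y = g x0 + 2^-1 * qform M (y - x0).
Proof.
rewrite /g; have -> : r = - (M *m x0) by rewrite Mx0 opprK.
rewrite !qformE mulmxBr !(dotvDl, dotvDr, dotvNl, dotvNr).
have -> : dotv x0 (M *m y) = dotv y (M *m x0) by rewrite dotvC dotv_mull Msym.
rewrite !(dotvC (M *m x0)); lra.
Qed.

Lemma quadratic_min_value : g x0 = - (2^-1 * qform M x0).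
Proof.
rewrite /g; have -> : r = - (M *m x0) by rewrite Mx0 opprK.
rewrite qformE dotvNl (dotvC (M *m x0)); lra.
Qed.

Lemma quadratic_argmin : posdefmx M -> is_argmin g x0.
Proof.
move=> Mpos y yx0; rewrite (quadratic_gap y) ltrDl mulr_gt0 ?invr_gt0 ?ltr0n //.
by apply: Mpos; rewrite subr_eq0.
Qed.

End QuadraticMinimum.

(** * Block decomposition and the dominance bound *)

Section Blocks.
Context {R : realType} {N : nat} {p : 'I_N -> nat}.
Implicit Types (Q : 'M[R]_(\sum_(i < N) p i)) (x : 'cV[R]_(\sum_(i < N) p i)).

Lemma dotv_blocks x y : dotv x y = \sum_i dotv (submxcol x i) (submxcol y i).
Proof.
rewrite /dotv -{1}(submxcolK x) -{1}(submxcolK y) tr_mxcol mul_mxrow_mxcol.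
by rewrite summxE.
Qed.

Lemma submxcol_mulmx Q x i :
  submxcol (Q *m x) i = \sum_j submxblock Q i j *m submxcol x j.
Proof.
rewrite -submxcol_mul -{1}(submxcolK x) -{1}(submxrowK (submxcol Q i)).
rewrite mul_mxrow_mxcol; apply: eq_bigr => j _.
by rewrite submxblockEv.
Qed.

Lemma qform_blocks Q x :
  qform Q x = \sum_i \sum_j dotv (submxcol x i) (submxblock Q i j *m submxcol x j).
Proof.
rewrite qformE dotv_blocks; apply: eq_bigr => i _; rewrite submxcol_mulmx.
by rewrite /dotv mulmx_sumr summxE.
Qed.

Lemma qform_mxdiag (alpha : 'I_N -> R) x :
  qform (\mxdiag_i (alpha i)%:M) x =
  \sum_i alpha i * dotv (submxcol x i) (submxcol x i).
Proof.
rewrite qformE -{2}(submxcolK x) mul_mxdiag_mxcol dotv_blocks.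
by apply: eq_bigr => i _; rewrite mxcolK mul_scalar_mx dotvZr.
Qed.

Lemma posdefmx_submxblock Q i : posdefmx Q -> posdefmx (submxblock Q i i).
Proof.
move=> Qpos y y0.
(* [E] pads a vector of block [i] with zeros, so the diagonal block is the compression [E^T Q E]. It
   is injective because [E^T E = 1]. *)
pose E : 'M[R]_(_, p i) := submxrow 1%:M i.
have ET : E^T = submxcol 1%:M i by rewrite tr_submxrow trmx1.
have EQ M : submxblock M i i = E^T *m M *m E.
  by rewrite ET submxcol_mul mul_submxrow mul1mx mulmx1 submxblockEv.
have -> : qform (submxblock Q i i) y = qform Q (E *m y).
  by rewrite /qform EQ trmx_mul !mulmxA.
apply: Qpos; apply: contra y0 => /eqP Ey.
have : E^T *m 1%:M *m E *m y = 0 by rewrite -mulmxA Ey mulmx0.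
rewrite -EQ; have -> : submxblock 1%:M i i = 1%:M :> 'M[R]_(p i).
  by rewrite -mxdiagZ submxblock_diag.
by rewrite mul1mx => ->.
Qed.

(** A block Gershgorin argument. Diagonal blocks are bounded below through the norm of their
    inverse, and each off-diagonal term costs at most [c i j] times the mean of [w i] and [w j]. *)
Lemma qform_ge_bdelta Q x : Q^T = Q -> posdefmx Q ->
  \sum_i bdelta Q i * dotv (submxcol x i) (submxcol x i) <= qform Q x.
Proof.
move=> Qsym Qpos; rewrite qform_blocks.
pose c i j := mnorm2 (submxblock Q i j).
pose w i := dotv (submxcol x i) (submxcol x i).
have csym i j : c i j = c j i by rewrite /c -mnorm2_tr tr_submxblock Qsym.
have offdiag i j : - (c i j * (2^-1 * (w i + w j)))
    <= dotv (submxcol x i) (submxblock Q i j *m submxcol x j).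
  apply: lerNnormlW.
  apply: le_trans (dotv_mulmx_le _ _ _) _; rewrite ler_wpM2l ?mnorm2_ge0 //.
  rewrite /w -!sqr_vnorm2.
  by have := sqr_ge0 (vnorm2 (submxcol x i) - vnorm2 (submxcol x j)); lra.
(* Symmetry of [c] moves the share charged to [w j] back to row [i], so row [i] loses in total the
   off-diagonal sum of [bdelta] times [w i]. *)
have swap : \sum_i \sum_(j | j != i) c i j * w j
          = \sum_i \sum_(j | j != i) c i j * w i.
  rewrite (exchange_big_dep xpredT) //=; apply: eq_bigr => j _.
  by apply: eq_big => i; rewrite 1?eq_sym // csym.
have -> : \sum_i bdelta Q i * w i =
  \sum_i ((mnorm2 (invmx (submxblock Q i i)))^-1 * w i
          + \sum_(j | j != i) - (c i j * (2^-1 * (w i + w j)))).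
  rewrite big_split /=.
  have -> : \sum_i \sum_(j | j != i) - (c i j * (2^-1 * (w i + w j)))
      = - \sum_i \sum_(j | j != i) c i j * w i.
    transitivity (- (2^-1 * (\sum_i \sum_(j | j != i) c i j * w i
                    + \sum_i \sum_(j | j != i) c i j * w j))).
      rewrite -big_split mulr_sumr -sumrN; apply: eq_bigr => i _.
      rewrite -big_split mulr_sumr -sumrN; apply: eq_bigr => j _ /=; ring.
    by rewrite swap; lra.
  rewrite -sumrB; apply: eq_bigr => i _.
  by rewrite /bdelta mulrBl mulr_suml.
apply: ler_sum => i _; rewrite [leRHS](bigD1 i) //= lerD //.
  rewrite -qformE; apply: posdefmx_ge_mnorm2_inv; last exact: posdefmx_submxblock.
  by rewrite tr_submxblock Qsym.
by apply: ler_sum => j _; apply: offdiag.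
Qed.

End Blocks.

(** * The error estimate for general symmetric matrices *)

(** Used with [t] the square root of [eps], [u] the regularized minimizer and [d] the step from it
    to the minimizer of [f]. *)
Lemma regularization_error_le {R : realType} {n : nat} (Q A : 'M[R]_n)
    (u d : 'cV[R]_n) (t : R) :
  Q^T = Q -> A^T = A -> (forall x, 0 <= qform A x) -> 0 < t -> t < 1 ->
  (forall x, qform A x <= t / (1 - t) * qform Q x) ->
  Q *m d = A *m u ->
  qform Q d <= t ^+ 2 * qform Q (u + d).
Proof.
move=> Qsym Asym Apos t0 t1 AQ Qd.
have dQd : qform Q d = dotv d (A *m u) by rewrite qformE Qd.
have s0 : 0 < 1 - t by rewrite subr_gt0.
have c0 : 0 < t / (1 - t) by rewrite divr_gt0.
(* Cauchy-Schwarz bounds [qform Q d ^+ 2] by [qform A d * qform A u], and [AQ] bounds [qform A d];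
   cancel one factor [qform Q d] if it is positive. *)
have gap : qform Q d <= t / (1 - t) * qform A u.
  have := cauchy_schwarz_qform d u Asym Apos.
  rewrite -dQd => /le_trans/(_ (ler_wpM2r (Apos u) (AQ d))).
  have [z|] := ltP 0 (qform Q d).
    by rewrite expr2 mulrAC ler_pM2r.
  by move=> z _; apply: le_trans z _; rewrite mulr_ge0 // ltW.
have qud : qform Q (u + d) = qform Q u + 2 * qform A u + qform Q d.
  rewrite !qformE mulmxDr !(dotvDl, dotvDr) Qd.
  have -> : dotv d (Q *m u) = dotv u (A *m u) by rewrite dotvC dotv_mull Qsym Qd.
  by ring.
have scale a b : (a <= t / (1 - t) * b) = ((1 - t) * a <= t * b).
  by rewrite mulrAC ler_pdivlMr // [a * _]mulrC.
rewrite qud; move: gap (AQ u); rewrite !scale.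
move: (qform Q d) (qform A u) (qform Q u) => D k U gap kU.
(* The multipliers [t] and [1 + t] give [(1 - t^2) D <= t k + t^2 k <= t^2 U + 2 t^2 k], which is
   the goal rearranged. *)
have := ler_wpM2l (ltW t0) kU.
have : (1 + t) * ((1 - t) * D) <= (1 + t) * (t * k) by rewrite ler_wpM2l //; lra.
by lra.
Qed.

(** * Both minimizers and the relative error bound *)

Theorem theorem7 (R : realType) (N : nat) (p : 'I_N -> nat)
    (p_gt0 : forall i : 'I_N, (0 < p i)%N)
    (Q : 'M[R]_(\sum_(i < N) p i))
    (Qsym : Q^T = Q)
    (Qpos : posdefmx Q)
    (Qdom : strictly_block_diag_dominant Q)
    (alpha : 'I_N -> R)
    (alpha_gt0 : forall i : 'I_N, 0 < alpha i)
    (r : 'cV[R]_(\sum_(i < N) p i))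
    (r_neq0 : r != 0)
    (eps : R) (eps_gt0 : 0 < eps) (eps_lt1 : eps < 1) :
  let A : 'M[R]_(\sum_(i < N) p i) := \mxdiag_(i < N) (alpha i)%:M in
  let P := Q + A in
  let f := fun x : 'cV[R]_(\sum_(i < N) p i) =>
    2^-1 * qform Q x + (r^T *m x) 0 0 in
  let xhat := - (invmx Q *m r) in
  let xhatA := - (invmx P *m r) in
  is_argmin f xhat /\
  is_argmin (fun x => f x + 2^-1 * qform A x) xhatA /\
  ((forall i : 'I_N,
      alpha i <= Num.sqrt eps / (1 - Num.sqrt eps) * bdelta Q i) ->
   `|f xhat - f xhatA| / `|f xhat| <= eps).
Proof.
move=> A P f xhat xhatA.
have Asym : A^T = A.
  by rewrite /A tr_mxdiag; apply: eq_mxdiag => i; rewrite tr_scalar_mx.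
have Apos x : 0 <= qform A x.
  rewrite qform_mxdiag; apply: sumr_ge0 => i _.
  by rewrite mulr_ge0 ?dotv_ge0 // ltW.
have Psym : P^T = P by rewrite /P linearD /= Qsym Asym.
have Ppos : posdefmx P by move=> x x0; rewrite /P qformD ltr_wpDr // Qpos.
have Qxhat : Q *m xhat = - r.
  by rewrite /xhat mulmxN mulKVmx // posdefmx_unit.
have PxhatA : P *m xhatA = - r.
  by rewrite /xhatA mulmxN mulKVmx // posdefmx_unit.
split; first exact: (quadratic_argmin Qsym Qxhat Qpos).
split.
  move=> y yx; have := quadratic_argmin Psym PxhatA Ppos yx.
  by rewrite /P !qformD /dotv /f; lra.
move=> alpha_le.
have [t0 t1] : 0 < Num.sqrt eps /\ Num.sqrt eps < 1.
  by rewrite sqrtr_gt0 eps_gt0 -sqrtr1 ltr_sqrt ?ltr01.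
(* [r != 0] keeps the denominator [f xhat] away from zero. *)
have xhat0 : 0 < qform Q xhat.
  apply: Qpos; apply: contra r_neq0 => /eqP x0.
  by rewrite -oppr_eq0 -Qxhat x0 mulmx0.
have fgap : f xhatA = f xhat + 2^-1 * qform Q (xhat - xhatA).
  have -> : qform Q (xhat - xhatA) = qform Q (xhatA - xhat).
    by rewrite -opprB !qformE mulmxN dotvNl dotvNr opprK.
  exact: (quadratic_gap Qsym Qxhat).
have fmin : f xhat = - (2^-1 * qform Q xhat) by apply: (quadratic_min_value Qxhat).
have gap0 := posdefmx_ge0 (xhat - xhatA) Qpos.
rewrite fgap opprD addNKr fmin !normrN !ger0_norm; try lra.
(* The factors [2^-1] cancel, leaving a ratio of two values of [qform Q]. *)
rewrite -mulf_div divff ?invr_eq0 ?pnatr_eq0 // mul1r ler_pdivrMr //.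
rewrite -(sqr_sqrtr (ltW eps_gt0)).
rewrite -{2}(subrK xhatA xhat) [_ - _ + _]addrC.
apply: (regularization_error_le Qsym Asym Apos t0 t1) => [x|].
  (* The hypothesis on [alpha], weighted by the squared block norms of [x] and summed, meets the
     dominance bound. *)
  apply: le_trans (ler_wpM2l _ (qform_ge_bdelta x Qsym Qpos)); last first.
    by rewrite divr_ge0 ?subr_ge0 ?ltW.
  rewrite qform_mxdiag mulr_sumr; apply: ler_sum => i _.
  by rewrite mulrA ler_wpM2r ?dotv_ge0.
(* Replacing [- r] by [P *m xhatA] leaves [(P - Q) *m xhatA], that is [A *m xhatA]. *)
by rewrite mulmxBr Qxhat -PxhatA /P mulmxDl addrAC subrr add0r.
Qed.
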